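(* Every pre-ordered vector space possesses a unique, up to an order isomorphism, almost Archimedeanization.
   Context: All vector spaces are real. A non-empty subset $W$ of a vector space $X$ is a wedge if $W+W\subseteq W$ and $tW\subseteq W$ for all $t\ge 0$; a wedge $C$ is a cone if $C\cap -C=\{0\}$. A pre-ordered vector space (POVS) is a vector space $X$ together with a wedge $X_+$; write $x\le y$ iff $y-x\in X_+$. If $X_+$ is a cone, $X$ is an ordered vector space (OVS). A POVS $X$ is almost Archimedean if $y=0$ whenever there is $u\in X_+$ with $\pm ny\le u$ for all $n\in\mathbb N$. A linear operator $T:X\to Y$ between POVSs is positive if $T(X_+)\subseteq Y_+$; an order isomorphism is a linear bijection that is positive together with its inverse. Almost Archimedeanization: for a POVS $X$, let $\mathcal C^a_{Arch}(X)$ be the category whose objects are pairs $\langle Y,\phi\rangle$ with $Y$ an almost Archimedean OVS and $\phi:X\to Y$ a positive linear operator, and whose morphisms $\langle Y_1,\phi_1\rangle\to\langle Y_2,\phi_2\rangle$ are positive linear operators $\psi:Y_1\to Y_2$ with $\psi\circ\phi_1=\phi_2$. If $\langle Y_0,\phi_0\rangle$ is an initial object of $\mathcal C^a_{Arch}(X)$, then the OVS $Y_0$ is called an almost Archimedeanization of $X$. *)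

(* Defs.v *)
From HB Require Import structures.
From mathcomp Require Import all_boot all_order all_algebra.
From mathcomp Require Import boolp classical_sets reals.

Set Implicit Arguments.
Unset Strict Implicit.
Unset Printing Implicit Defensive.

Import Order.TTheory GRing.Theory Num.Theory.
Local Open Scope classical_set_scope.
Local Open Scope ring_scope.

Definition wedge (R : realType) (X : lmodType R) (W : set X) : Prop :=
  [/\ W !=set0,
      (forall x y, W x -> W y -> W (x + y)) &
      (forall (t : R) x, 0 <= t -> W x -> W (t *: x))].

Definition cone (R : realType) (X : lmodType R) (C : set X) : Prop :=
  wedge C /\ C `&` [set x | C (- x)] = [set 0].

Record povs (R : realType) : Type := Povs {
  povs_sort :> lmodType R;
  povs_pos : set povs_sort;
  povs_posP : wedge povs_pos
}.

Section OrderedVectorSpaces.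
Variable R : realType.
Implicit Types X Y : povs R.

Definition povs_le X (x y : X) : Prop := povs_pos (y - x).

Definition is_ovs X : Prop := cone (@povs_pos R X).

Definition almost_archimedean X : Prop :=
  forall y : X,
    (exists2 u : X, povs_pos u &
       forall n : nat, povs_le (y *+ n) u /\ povs_le (- (y *+ n)) u) ->
    y = 0.

Definition positive X Y (T : X -> Y) : Prop :=
  forall x : X, povs_pos x -> povs_pos (T x).

Definition order_isomorphism X Y (T : {linear X -> Y}) : Prop :=
  positive T /\
  exists S : Y -> X, [/\ cancel T S, cancel S T & positive S].

Definition order_isomorphic X Y : Prop :=
  exists T : {linear X -> Y}, order_isomorphism T.

Record aArch_obj X : Type := AArchObj {
  aArch_space : povs R;
  aArch_map : {linear X -> aArch_space};
  aArch_ovs : is_ovs aArch_space;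
  aArch_aarch : almost_archimedean aArch_space;
  aArch_map_pos : positive aArch_map
}.

Definition aArch_hom X (A B : aArch_obj X)
    (psi : {linear aArch_space A -> aArch_space B}) : Prop :=
  positive psi /\ psi \o aArch_map A = aArch_map B.

Definition aArch_initial X (A : aArch_obj X) : Prop :=
  forall B : aArch_obj X,
    exists! psi : {linear aArch_space A -> aArch_space B}, aArch_hom psi.

Definition almost_archimedeanization X Y : Prop :=
  exists2 A : aArch_obj X, aArch_initial A & aArch_space A = Y.

End OrderedVectorSpaces.

(* Main.v *)
Require Import Defs.
From HB Require Import structures.
From mathcomp Require Import all_boot all_order all_algebra reals.
From mathcomp Require Import ring_quotient boolp classical_sets.

(** Existence.  Let N be the intersection of the kernels of all positive linear
    maps from X to almost Archimedean ordered spaces, and give X / N the image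
    of the positive wedge of X.  If u + N bounds the multiples of y + N and
    their opposites, then every positive map f into an almost Archimedean space
    factors through X / N positively, so f u bounds the multiples of f y and
    their opposites, and f y = 0.  Since f is arbitrary, y lies in N: the
    quotient is almost Archimedean ([aArch_quotient_aarch]).  Its wedge is then
    automatically a cone, because y and - y both positive means that 0 bounds
    every multiple of y ([almost_archimedean_is_ovs]).  The projection is
    initial: each f vanishes on N, so it descends to the quotient, and it does
    so uniquely because the projection is onto.

    N is cut out by a quantification over all almost Archimedean spaces under X,
    which is legitimate because Prop is impredicative; this replaces the
    transfinite iteration of quotients that would build N from inside X.

    Uniqueness is the usual argument for initial objects: the two canonical
    morphisms compose to endomorphisms of initial objects, hence to
    identities. *)

Set Implicit Arguments.
Unset Strict Implicit.
Unset Printing Implicit Defensive.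

(** * Quotient of a module by a submodule *)

Section QuotientModule.
Import GRing.Theory.
Local Open Scope ring_scope.
Local Open Scope quotient_scope.
Variables (R : pzRingType) (V : lmodType R) (S : {pred V}).
Hypothesis S_closed : submod_closed S.

(** The additive quotient is indexed by a bundled subgroup, so the subgroup
    underlying the submodule has to be packed first. *)
Definition submod_zmod : zmodClosed V :=
  HB.pack_for (zmodClosed V) S
    (GRing.isZmodClosed.Build V S (GRing.submod_closedB S_closed)).

(** A separate name for the additive quotient, so that its module structure,
    which depends on closure under scaling, is attached to this name only. *)
Definition lquot := Quotient.quot submod_zmod.

HB.instance Definition _ := GRing.Zmodule.on lquot.

Definition lquot_proj (x : V) : lquot := \pi_lquot x.

Lemma lquot_projB : {morph lquot_proj : x y / x - y}.
Proof. exact: raddfB. Qed.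

Lemma lquot_projK : cancel repr lquot_proj.
Proof. exact: reprK. Qed.

Lemma lquot_proj_eq0 x : (lquot_proj x = 0) <-> x \in S.
Proof.
rewrite -{2}[x]subr0 -[_ \in S]/(_ \in submod_zmod) Quotient.idealrBE.
rewrite -[X in _ = X](raddf0 (\pi_lquot)); by split=> [/eqP|/eqP].
Qed.

Lemma lquot_proj_eq x y : lquot_proj x = lquot_proj y <-> x - y \in S.
Proof.
by rewrite -lquot_proj_eq0 lquot_projB; split=> [->|/subr0_eq//]; rewrite subrr.
Qed.

Definition lquot_scale (a : R) (v : lquot) : lquot := lquot_proj (a *: repr v).

Lemma lquot_projZ a x : lquot_proj (a *: x) = lquot_scale a (lquot_proj x).
Proof.
apply/lquot_proj_eq; rewrite -scalerBr; apply: (GRing.submod_closed_semi S_closed).2.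
by apply/lquot_proj_eq; rewrite lquot_projK.
Qed.

Lemma lquot_scaleA a b v :
  lquot_scale a (lquot_scale b v) = lquot_scale (a * b) v.
Proof. by rewrite -[v]lquot_projK -!lquot_projZ scalerA. Qed.

Lemma lquot_scale1 : left_id 1 lquot_scale.
Proof. by move=> v; rewrite -[v]lquot_projK -lquot_projZ scale1r. Qed.

Lemma lquot_projD : {morph lquot_proj : x y / x + y}.
Proof. exact: raddfD. Qed.

Lemma lquot_scaleDr : right_distributive lquot_scale +%R.
Proof.
move=> a u v; rewrite -[u]lquot_projK -[v]lquot_projK.
by rewrite -lquot_projD -!lquot_projZ scalerDr lquot_projD.
Qed.

Lemma lquot_scaleDl v : {morph lquot_scale^~ v : a b / a + b}.
Proof.
by move=> a b; rewrite -[v]lquot_projK -!lquot_projZ scalerDl lquot_projD.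
Qed.

HB.instance Definition _ := GRing.Zmodule_isLmodule.Build R lquot
  lquot_scaleA lquot_scale1 lquot_scaleDr lquot_scaleDl.

Lemma lquot_proj_linear : linear lquot_proj.
Proof. by move=> a x y; rewrite lquot_projD lquot_projZ. Qed.

HB.instance Definition _ :=
  GRing.isLinear.Build R V lquot *:%R lquot_proj lquot_proj_linear.

(** A linear map that vanishes on the submodule takes the same value on all
    representatives of a class, so evaluating it at the chosen one is linear. *)
Lemma lquot_universal (W : lmodType R) (f : {linear V -> W}) :
  (forall x, x \in S -> f x = 0) ->
  exists g : {linear lquot -> W}, forall x, g (lquot_proj x) = f x.
Proof.
move=> fS0; pose g (v : lquot) : W := f (repr v).
have gE x : g (lquot_proj x) = f x.
  apply/subr0_eq; rewrite -raddfB; apply: fS0.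
  by apply/lquot_proj_eq; rewrite lquot_projK.
have g_linear : linear g.
  move=> a u v; rewrite -[u]lquot_projK -[v]lquot_projK.
  by rewrite -linearP !gE linearP.
by exists (HB.pack_for {linear lquot -> W} g
  (GRing.isLinear.Build R lquot W *:%R g g_linear)).
Qed.

End QuotientModule.

(** * Almost Archimedean spaces *)

Section AlmostArchimedeanization.
Import Order.TTheory GRing.Theory Num.Theory.
Local Open Scope classical_set_scope.
Local Open Scope ring_scope.
Variable R : realType.

(** Bundled linear maps carry proofs of linearity; proof irrelevance makes them
    extensional, as uniqueness of morphisms demands. *)
Lemma linear_ext (U V : lmodType R) (f g : {linear U -> V}) : f =1 g -> f = g.
Proof.
move=> /funext; case: f g => f [[f1] [f2]] [g [[g1] [g2]]] /= fg; subst g.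
by rewrite (Prop_irrelevance f1 g1) (Prop_irrelevance f2 g2).
Qed.

(** If y and - y are both positive, every multiple of y lies between 0 and 0,
    so the upper bound u = 0 forces y = 0. *)
Lemma almost_archimedean_is_ovs (Y : povs R) :
  almost_archimedean Y -> is_ovs Y.
Proof.
move=> aaY; have [[w Yw] YD YZ] := povs_posP Y.
have Y0 : povs_pos (0 : Y) by rewrite -(scale0r w); apply: YZ.
have YMn (y : Y) n : povs_pos y -> povs_pos (y *+ n).
  by move=> Yy; rewrite -scaler_nat; apply: YZ => //; apply: ler0n.
split; first exact: povs_posP.
rewrite eqEsubset; split=> [y [Yy YNy]|_ ->]; last by split=> //=; rewrite oppr0.
apply: aaY; exists 0 => // n; rewrite /povs_le !sub0r opprK -mulNrn.
by split; apply: YMn.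
Qed.

Lemma povs_le_linear (X Y : povs R) (f : {linear X -> Y}) x y :
  povs_le (f x) (f y) = povs_pos (f (y - x)).
Proof. by rewrite /povs_le raddfB. Qed.

Section Quotient.
Variables (X : povs R) (N : {pred X}) (N_closed : submod_closed N).

Lemma image_wedge : wedge (lquot_proj N_closed @` @povs_pos R X).
Proof.
have [[w Xw] XD XZ] := povs_posP X; split.
- by exists (lquot_proj N_closed w), w.
- by move=> _ _ [x Xx <-] [y Xy <-]; exists (x + y); rewrite ?raddfD //; apply: XD.
- by move=> t _ t0 [x Xx <-]; exists (t *: x); rewrite ?linearZ //; apply: XZ.
Qed.

Definition quotient_povs : povs R := Povs image_wedge.

End Quotient.

(** * The quotient by the common kernel *)

Variable X : povs R.

Definition aArch_null : {pred X} :=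
  [pred x | `[< forall B : aArch_obj X, aArch_map B x = 0 >]].

Lemma aArch_null_submod_closed : submod_closed aArch_null.
Proof.
split=> [|a x y /asboolP Nx /asboolP Ny]; apply/asboolP => B.
  by rewrite raddf0.
by rewrite linearP Nx Ny scaler0 addr0.
Qed.

Definition aArch_quotient : povs R := quotient_povs aArch_null_submod_closed.

(** The projection with its codomain typed as an ordered space, which is the
    form that the objects under X and the order relation require. *)
Definition aArch_proj : {linear X -> aArch_quotient} :=
  lquot_proj aArch_null_submod_closed.

Lemma aArch_projP (y : aArch_quotient) : exists x, y = aArch_proj x.
Proof. by exists (repr y); rewrite /aArch_proj/= lquot_projK. Qed.

Lemma aArch_proj_eq0 x :
  aArch_proj x = 0 <-> forall B : aArch_obj X, aArch_map B x = 0.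
Proof. by rewrite lquot_proj_eq0; split=> /asboolP. Qed.

(** An inequality in the quotient holds in X up to an element of the common
    kernel, and no positive map into an almost Archimedean space sees that
    element. *)
Lemma povs_le_proj_map (B : aArch_obj X) x y :
  povs_le (aArch_proj x) (aArch_proj y) ->
  povs_le (aArch_map B x) (aArch_map B y).
Proof.
rewrite !povs_le_linear => -[z Xz /esym zE].
suff -> : aArch_map B (y - x) = aArch_map B z by apply: aArch_map_pos.
apply/subr0_eq; rewrite -raddfB.
by apply/aArch_proj_eq0: B; rewrite raddfB; apply/eqP; rewrite subr_eq0; apply/eqP.
Qed.

(** The bounds on y in the quotient are tested against one map at a time; each
    target is already almost Archimedean, so each map kills y, and being killed
    by all of them is being zero in the quotient. *)
Lemma aArch_quotient_aarch : almost_archimedean aArch_quotient.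
Proof.
move=> y [u _]; have [x ->] := aArch_projP y; have [z ->] := aArch_projP u => xz.
apply/aArch_proj_eq0 => B; apply: aArch_aarch.
exists (aArch_map B z) => [|n].
  (* Positivity of the bound is the case n = 0 of the hypothesis. *)
  have /povs_le_proj_map : povs_le (aArch_proj 0) (aArch_proj z).
    by rewrite raddf0; have [] := xz 0%N; rewrite mulr0n.
  by move=> /(_ B); rewrite povs_le_linear subr0.
have [xz1 xz2] := xz n.
by split; rewrite -raddfMn -?raddfN; apply: povs_le_proj_map;
   rewrite ?raddfN raddfMn.
Qed.

Lemma aArch_proj_pos : positive aArch_proj.
Proof. by move=> x Xx; exists x. Qed.

Definition aArch_quotient_obj : aArch_obj X :=
  AArchObj (almost_archimedean_is_ovs aArch_quotient_aarch)
    aArch_quotient_aarch aArch_proj_pos.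

Lemma aArch_quotient_initial : aArch_initial aArch_quotient_obj.
Proof.
move=> B; have [x /asboolP|psi psiE] :=
  lquot_universal aArch_null_submod_closed (f := aArch_map B).
  exact.
exists psi; split=> [|psi' [_ psi'E]].
  split; last exact/funext.
  by move=> _ [x Xx <-]; rewrite psiE; apply: aArch_map_pos.
apply: linear_ext => y; have [x ->] := aArch_projP y.
by rewrite psiE -psi'E.
Qed.

(** The inverse produced by initiality is itself a morphism, hence positive;
    this is what turns the linear bijection into an order isomorphism. *)
Lemma initial_order_isomorphic (A B : aArch_obj X) :
  aArch_initial A -> aArch_initial B ->
  order_isomorphic (aArch_space A) (aArch_space B).
Proof.
have endo_id (C : aArch_obj X) (f : {linear aArch_space C -> aArch_space C}) :
    aArch_initial C -> aArch_hom f -> f =1 id.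
  move=> /(_ C)[g [_ g_uniq]] f_hom.
  have idE : g = idfun :> {linear _ -> _} by apply: g_uniq; split.
  by rewrite -(g_uniq _ f_hom) idE.
move=> iA iB; have [f [[f_pos fE] _]] := iA B; have [g [[g_pos gE] _]] := iB A.
exists f; split=> //; exists g; split=> //.
- apply: (endo_id A (g \o f) iA); split; first by move=> x /f_pos/g_pos.
  by rewrite /= -compA fE.
- apply: (endo_id B (f \o g) iB); split; first by move=> x /g_pos/f_pos.
  by rewrite /= -compA gE.
Qed.

End AlmostArchimedeanization.

Theorem theorem3p1 (R : realType) (X : povs R) :
  (exists Y : povs R, almost_archimedeanization X Y) /\
  (forall Y1 Y2 : povs R,
      almost_archimedeanization X Y1 -> almost_archimedeanization X Y2 ->
      order_isomorphic Y1 Y2).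
Proof.
split.
  exists (aArch_quotient X), (aArch_quotient_obj X) => //.
  exact: aArch_quotient_initial.
move=> _ _ [A iA <-] [B iB <-]; exact: initial_order_isomorphic.
Qed.
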